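(* Let $G$ be a finite group and let $C$ be a conjugacy class in $G$ of prime order $p$ (i.e. $|C|=p$ with $p$ prime). Assume that the center $Z(G)$ of $G$ is trivial and that $G$ is generated by $C$. Then $G$ is (isomorphic to) a subgroup of the affine group of degree $p$.
   Context: The affine group of degree $p$ is the group of all permutations of $\mathbb{Z}_p=\mathbb{Z}/p\mathbb{Z}$ of the form $x\mapsto ax+b$ with $a\in\mathbb{Z}_p^*$, $b\in\mathbb{Z}_p$. The order of a conjugacy class is its cardinality. *)

(* Defs.v *)
From HB Require Import structures.
From mathcomp Require Import all_boot all_order all_algebra all_fingroup all_solvable.

Set Implicit Arguments.
Unset Strict Implicit.
Unset Printing Implicit Defensive.

Import GRing.Theory.
Local Open Scope ring_scope.

(* 'Z_p is Z/pZ only for p > 1; affine_group is only meant for such p. *)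
Definition affine_set (p : nat) : {set {perm 'Z_p}} :=
  [set s : {perm 'Z_p} |
    [exists a : 'Z_p, exists b : 'Z_p,
      (a \is a GRing.unit) && [forall x : 'Z_p, s x == a * x + b]]].

Lemma affine_setP (p : nat) (s : {perm 'Z_p}) :
  reflect (exists a b : 'Z_p,
             a \is a GRing.unit /\ forall x : 'Z_p, s x = a * x + b)
          (s \in affine_set p).
Proof.
rewrite inE; apply: (iffP existsP) => [[a /existsP[b /andP[ua /forallP sE]]]|].
  by exists a, b; split=> // x; apply/eqP.
case=> a [b [ua sE]]; exists a; apply/existsP; exists b.
by rewrite ua; apply/forallP=> x; rewrite sE.
Qed.

Lemma affine_group_set (p : nat) : group_set (affine_set p).
Proof.
apply/group_setP; split.
  apply/affine_setP; exists 1, 0; split; first exact: unitr1.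
  by move=> x; rewrite perm1 mul1r addr0.
move=> s t /affine_setP[a [b [ua sE]]] /affine_setP[c [d [uc tE]]].
apply/affine_setP; exists (c * a), (c * b + d); split; first by rewrite unitrM uc.
by move=> x; rewrite permM sE tE mulrDr mulrA addrA.
Qed.

Canonical affine_group (p : nat) : {group {perm 'Z_p}} :=
  Group (affine_group_set p).

(* Main.v *)
Require Import Defs.
From mathcomp Require Import all_boot all_order all_algebra all_fingroup all_solvable.
From mathcomp Require Import all_field all_character.

(** Let x be in C and N = G'. The group G acts faithfully and transitively by
conjugation on the p points of C, so a nontrivial p-element g of G acts as a
p-cycle and 'C_G[g] = <[g]>; in particular p divides |G| exactly once.
A nonlinear irreducible character chi vanishes at x if p does not divide
chi(1) (as x is not central modulo the kernel), and at g if p does.  Hence for g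
in N of order p only the linear characters contribute to the number of ways of
writing g as a product of a conjugate of x and a conjugate of x^-1, and this
number is p^2 |G : N| / |G| = p^2 / |N|.  So |N| divides p^2, whence N = <[g]>
has order p.  Identifying C with Z/p through i |-> x ^ (g ^+ i), conjugation by
any element of G is affine because G normalises <[g]>. *)

Set Implicit Arguments.
Unset Strict Implicit.
Unset Printing Implicit Defensive.

Import Order.TTheory GRing.Theory Num.Theory GroupScope.

(** * Conjugation action of [p]-elements on the class *)

Section PrimeClass.

Variables (gT : finGroupType) (G : {group gT}) (x : gT) (p : nat).
Hypotheses (Gx : x \in G) (p_pr : prime p) (card_xG : #|x ^: G| = p).
Hypotheses (Z1 : 'Z(G) = 1) (genG : <<x ^: G>> = G).

(** Faithfulness of the action: what fixes a generating set pointwise is central. *)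
Lemma centralise_class_eq1 (h : gT) :
  h \in G -> (forall y, y \in x ^: G -> y ^ h = y) -> h = 1.
Proof.
move=> Gh hC; apply/set1P; rewrite -[[set _]]Z1 inE Gh -genG cent_gen /=.
by apply/centP=> y /hC cy; apply/commute_sym/commgP/conjg_fixP.
Qed.

(** Faithfulness gives a nontrivial orbit of [<[g]>]; its size is a power of [p], hence at least
    [p], and the class has only [p] points. *)
Lemma class_pelt_transitive (g : gT) :
  g \in G -> p.-elt g -> g != 1 -> x ^: <[g]> = x ^: G.
Proof.
move=> Gg pg ng; have sgG : <[g]> \subset G by rewrite cycle_subG.
have [y Cy nfix] : exists2 y, y \in x ^: G & y ^ g != y.
  apply/exists_inP; apply: contraR ng.
  rewrite negb_exists_in => /forall_inP fixC.
  by apply/eqP/(centralise_class_eq1 Gg) => y /fixC; rewrite negbK => /eqP.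
have syC : y ^: <[g]> \subset x ^: G.
  by rewrite -(class_eqP Cy); apply: imsetS.
have := subset_leq_card syC; rewrite card_xG => le_p.
have p_card : p.-nat #|y ^: <[g]>|.
  by rewrite -index_cent1; apply: pnat_dvd pg; rewrite dvdn_indexg.
have gt1 : (1 < #|y ^: <[g]>|)%N.
  rewrite ltn_neqAle eq_sym card_gt0; apply/andP; split; last first.
    by apply/set0Pn; exists y; apply: class_refl.
  apply: contraNneq nfix => /eqP/cards1P[z yz].
  have := memJ_class y (cycle_id g); rewrite yz => /set1P->.
  by have := class_refl <[g]> y; rewrite yz => /set1P->.
have yC : y ^: <[g]> = x ^: G.
  apply/eqP; rewrite eqEcard syC card_xG.
  have /p_natP[k ek] := p_card; move: gt1; rewrite ek.
  by case: k {ek} => // k _; rewrite expnS leq_pmulr // expn_gt0 prime_gt0.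
have: x \in y ^: <[g]> by rewrite yC class_refl.
by move/class_eqP->.
Qed.

Lemma class_stab_pelt_cent (g h : gT) :
  g \in G -> p.-elt g -> g != 1 -> h \in 'C_G[g] -> x ^ h = x -> h = 1.
Proof.
move=> Gg pg ng /setIP[Gh /cent1P cgh] xh; apply: centralise_class_eq1 => // y.
rewrite -(class_pelt_transitive Gg pg ng) => /imsetP[k /cycleP[i ->] ->].
by rewrite -conjgM -(commuteX i cgh) conjgM xh.
Qed.

(** By transitivity [h] moves [x] as some [k] in [<[g]>] does; then [h * k^-1] commutes with [g] and
    fixes [x], so it is trivial. *)
Lemma cent1_pelt (g : gT) : g \in G -> p.-elt g -> g != 1 -> 'C_G[g] = <[g]>.
Proof.
move=> Gg pg ng; apply/eqP; rewrite eqEsubset subsetI !cycle_subG Gg cent1id.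
rewrite !andbT; apply/subsetP=> h Ch; have /setIP[Gh cgh] := Ch.
have: x ^ h \in x ^: <[g]>.
  by rewrite (class_pelt_transitive Gg pg ng) memJ_class.
case/imsetP=> k gk xhk; suff /eqP: h * k^-1 = 1.
  by rewrite -eq_mulgV1 => /eqP->.
apply: (class_stab_pelt_cent Gg pg ng).
  rewrite groupM // groupV inE (subsetP (_ : <[g]> \subset G)) ?cycle_subG //=.
  by move: k gk {xhk}; apply/subsetP; rewrite cycle_subG cent1id.
by rewrite conjgM xhk conjgK.
Qed.

Lemma order_pelt (g : gT) : g \in G -> p.-elt g -> g != 1 -> #[g] = p.
Proof.
move=> Gg pg ng.
rewrite -card_xG -(class_pelt_transitive Gg pg ng) -index_cent1.
suff -> : 'C_<[g]>[x] = 1 by rewrite indexg1.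
apply/trivgP/subsetP=> h /setIP[gh /cent1P cxh]; apply/set1P.
apply: (class_stab_pelt_cent Gg pg ng); first by rewrite cent1_pelt.
exact/conjg_fixP/commgP.
Qed.

(** A nontrivial central element [g] of a Sylow subgroup [P] forces [P] into ['C_G[g]], which has
    order [p]. *)
Lemma logn_card_prime_class : logn p #|G| = 1%N.
Proof.
have [P sylP] := Sylow_exists p G; have pP := pHall_pgroup sylP.
have sPG := pHall_sub sylP.
have dvd_p : p %| #|G| by rewrite -card_xG -index_cent1 dvdn_indexg.
apply/eqP; rewrite eqn_leq logn_gt0 mem_primes p_pr cardG_gt0 dvd_p andbT.
have ntZ : 'Z(P) != 1.
  apply: contraTneq dvd_p => /(trivg_center_pgroup pP) P1.
  have: p \notin \pi(#|G|) by rewrite -p_part_eq1 -(card_Hall sylP) P1 cards1.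
  by rewrite mem_primes p_pr cardG_gt0.
have [g /setIP[Pg cPg] ng] := trivgPn _ ntZ.
have Gg := subsetP sPG g Pg; have pg := mem_p_elt pP Pg.
have sPg : P \subset <[g]>.
  rewrite -(cent1_pelt Gg pg ng) subsetI sPG; apply/subsetP=> h Ph.
  by apply/cent1P/commute_sym/(centP cPg).
have := subset_leq_card sPg; rewrite -orderE (order_pelt Gg pg ng).
by rewrite (card_Hall sylP) p_part -[leqRHS]expn1 leq_exp2l ?prime_gt1 ?andbT.
Qed.

(** The orbit of [x] under the normal subgroup [D] has size 1 or [p]. Size 1 would make [D]
    centralise the whole class, so [G] would be abelian, hence trivial. *)
Lemma der1_dvd : p %| #|G^`(1)|.
Proof.
set D := G^`(1)%G; have nsDG : D <| G := der_normal 1 G.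
have sDG := normal_sub nsDG.
have dvd : #|D : 'C_D[x]| %| p.
  have -> : 'C_D[x] = D :&: 'C_G[x] by rewrite setIA (setIidPl sDG).
  have nDC : 'C_G[x] \subset 'N(D).
    by rewrite (subset_trans (subsetIl _ _)) // normal_norm.
  (* The index is that of ['C_G[x]] in its product with [D], a subgroup of [G]. *)
  rewrite -card_xG -index_cent1 indexgI -(indexMg 'C_G[x]%G D) -norm_joinEl //.
  by rewrite indexSg ?joing_subl // join_subG subsetIl.
have: #|D : 'C_D[x]| %| #|D| by exact: dvdn_indexg.
move: dvd; case/primeP: (p_pr) => p_gt1 div_p /div_p/pred2P[i1 _|-> //].
have: D \subset 'C_D[x] by rewrite -indexg_eq1 i1.
rewrite subsetI subxx /= => cDx.
have D1 : D = 1%G :> {group gT}.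
  apply/val_inj/trivgP/subsetP=> d Dd; apply/set1P.
  apply: centralise_class_eq1; first exact: subsetP sDG d Dd.
  move=> _ /imsetP[k Gk ->]; rewrite -{1}(conjgKV k d) -conjJg.
  have Ddk : d ^ k^-1 \in D.
    by rewrite memJ_norm // groupV (subsetP (normal_norm nsDG)).
  by congr (_ ^ k); apply/conjg_fixP/commgP/commute_sym/cent1P/(subsetP cDx).
have G1 : G :=: 1.
  by rewrite -Z1; apply/esym/center_idP/derG1P; apply: congr_group D1.
move: p_gt1; rewrite -card_xG (_ : x ^: G = [set x]) ?cards1 //.
by move: Gx; rewrite G1 => /set1P->; rewrite class1G.
Qed.

(** * Vanishing of nonlinear irreducible characters *)

Local Open Scope ring_scope.

(** Since the degree is coprime to the class size, a nonzero value puts [x] in the centre of the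
    character. That centre is normal, so it is all of [G]; being cyclic modulo the kernel, it makes
    the character linear. *)
Lemma irr_class_eq0_or_lin (i : Iirr G) :
  ~~ (p %| Num.truncn ('chi_i 1%g))%N ->
  'chi_i \isn't a linear_char -> 'chi_i x = 0.
Proof.
move=> p'chi1 nlin; apply: coprime_degree_support_cfcenter.
  by rewrite card_xG coprime_sym prime_coprime.
apply: contra nlin => Zx; rewrite lin_irr_der1.
have GZ : 'Z('chi_i)%CF = G.
  apply/eqP; rewrite eqEsubset cfcenter_sub -{1}genG gen_subG class_sub_norm //.
  exact: normal_norm (cfcenter_normal _).
have := cyclic_abelian (cfcenter_cyclic 'chi_i); rewrite GZ.
exact: der1_min (normal_norm (cfker_normal _)).
Qed.

Lemma card_class_pelt (g : gT) : g \in G -> p.-elt g -> g != 1%g ->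
  #|G| = (p * #|g ^: G|)%N.
Proof.
move=> Gg pg ng; rewrite -index_cent1 -(Lagrange (subsetIl G 'C[g])).
by rewrite /= cent1_pelt // -orderE order_pelt.
Qed.

(** Multiplied by the class size [k], the quotient is an integer multiple of the central character
    value at [g]; multiplied by [p], it is ['chi_i g]. As [k] and [p] are coprime, Bezout combines
    the two. *)
Lemma irr_pelt_div_Aint (i : Iirr G) (g : gT) :
  g \in G -> p.-elt g -> g != 1%g -> (p %| Num.truncn ('chi_i 1%g))%N ->
  'chi_i g / p%:R \in Aint.
Proof.
move=> Gg pg ng /dvdnP[e chi1E]; have p_gt0 := prime_gt0 p_pr.
have chi1 : 'chi_i 1%g = e%:R * p%:R.
  by rewrite -natrM -chi1E truncnK ?Cnat_irr1.
have pnz : p%:R != 0 :> algC by rewrite pnatr_eq0 -lt0n.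
have enz : e%:R != 0 :> algC.
  by apply: contraNneq (irr1_neq0 i) => e0; rewrite chi1 e0 mul0r.
set k := #|g ^: G|.
have kA : k%:R * ('chi_i g / p%:R) \in Aint.
  suffices ->: k%:R * ('chi_i g / p%:R)
      = e%:R * (k%:R * 'chi_i g / 'chi_i 1%g).
    by rewrite rpredM ?rpred_nat ?Aint_class_div_irr1.
  by rewrite chi1 mulrA [RHS]mulrA -[RHS]mulf_div divff // mul1r.
have k_gt0 : (0 < k)%N.
  by rewrite card_gt0; apply/set0Pn; exists g; apply: class_refl.
have co : coprime p k.
  rewrite prime_coprime //; apply/negP=> pk; have := logn_card_prime_class.
  rewrite (card_class_pelt Gg pg ng) lognM // logn_prime // eqxx add1n => -[].
  by apply/eqP; rewrite -lt0n logn_gt0 mem_primes p_pr k_gt0.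
have [u _ /dvdnP[v uv]] := Bezoutl k p_gt0.
suffices ->: 'chi_i g / p%:R
    = v%:R * 'chi_i g - u%:R * (k%:R * ('chi_i g / p%:R)).
  by rewrite rpredB // rpredM ?rpred_nat ?Aint_irr.
rewrite -[X in v%:R * X](divfK pnz) [_ * p%:R]mulrC !mulrA -!natrM -uv.
by rewrite (eqnP co) natrD !mulrDl mul1r addrK.
Qed.

Lemma irr_pelt_norm_le (i : Iirr G) (g : gT) :
  g \in G -> p.-elt g -> g != 1%g -> `|'chi_i g| ^+ 2 <= p%:R.
Proof.
move=> Gg pg ng; have := second_orthogonality_relation g Gg.
rewrite class_refl cent1_pelt // -orderE order_pelt // mulr1n => <-.
rewrite (bigD1 i) //= normCK lerDl sumr_ge0 // => j _; exact: mul_conjC_ge0.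
Qed.

(** As [p] divides the group order exactly once, this is the vanishing of a character of [p]-defect
    zero at a nontrivial [p]-element. *)
Lemma irr_pelt_eq0 (i : Iirr G) (g : gT) :
  g \in G -> p.-elt g -> g != 1%g -> (p %| Num.truncn ('chi_i 1%g))%N ->
  'chi_i g = 0.
Proof.
move=> Gg pg ng p_chi1; set P := <[g]>%G.
have og : #|P| = p by rewrite -orderE order_pelt.
have p_gt0 : (0 : algC) < p%:R by rewrite ltr0n prime_gt0.
have pnz : p%:R != 0 :> algC by rewrite gt_eqF.
have sPG : P \subset G by rewrite cycle_subG.
have P1 h : h \in P^#%g -> [/\ h \in G, p.-elt h & h != 1%g].
  case/setD1P=> nh Ph; split=> //; first exact: subsetP sPG h Ph.
  exact: mem_p_elt pg Ph.
(* S is at most (p - 1) / p; it is also an algebraic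
   integer, and rational by the norm formula for 'Res[P] 'chi_i, so it is 0. *)
pose S := \sum_(h in P^#%g) `|'chi_i h / p%:R| ^+ 2.
have S_ge0 : 0 <= S by apply: sumr_ge0 => h _; rewrite exprn_ge0.
have S_lt1 : S < 1.
  apply: (@le_lt_trans _ _ (\sum_(h in P^#%g) p%:R^-1)).
    apply: ler_sum => h /P1[Gh ph nh].
    rewrite normrM normfV normr_nat exprMn exprVn.
    rewrite ler_pdivrMr ?exprn_gt0 // expr2 mulKf //.
    exact: irr_pelt_norm_le.
  rewrite sumr_const -[ltLHS]mulr_natl ltr_pdivrMr // mul1r ltr_nat.
  by rewrite -og (cardsD1 1%g P) group1.
have S_aint : S \in Aint.
  apply: rpred_sum => h /P1[Gh ph nh]; rewrite normCK rpredM //.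
    exact: irr_pelt_div_Aint.
  by rewrite Aint_aut irr_pelt_div_Aint.
have S_rat : S \in Crat.
  have -> : S = (p%:R * '['Res[P] 'chi_i] - 'chi_i 1%g ^+ 2) / p%:R ^+ 2.
    rewrite (cfnormE (cfun_onG _)) og mulrA divff // mul1r (big_setD1 1%g) //=.
    rewrite cfResE // ger0_norm ?ltW ?irr1_gt0 //.
    rewrite [_ + \sum_(_ in _) _]addrC addrK mulr_suml.
    apply: eq_bigr => h /setD1P[_ Ph].
    by rewrite cfResE // normrM normfV normr_nat exprMn exprVn.
  have [e ->] := natrP (Cnat_irr1 i).
  have [|n ->] := natrP (_ : '['Res[P] 'chi_i] \in Num.nat).
    by rewrite Cnat_cfdot_char ?cfRes_char ?irr_char.
  by rewrite rpred_div ?rpredB ?rpredM ?rpredX ?rpred_nat.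
have : S \in Num.nat by rewrite natrEint S_ge0 andbT Cint_rat_Aint.
case/natrP=> n Sn; move: S_lt1; rewrite Sn ltrn1 ltnS leqn0 => /eqP n0.
have /psumr_eq0P S0 : S = 0 by rewrite Sn n0.
have /eqP : `|'chi_i g / p%:R| ^+ 2 = 0.
  by apply: S0 => [h _|]; rewrite ?exprn_ge0 // !inE ng cycle_id.
by rewrite expf_eq0 normr_eq0 mulf_eq0 invr_eq0 (negPf pnz) orbF => /eqP.
Qed.

(** * Order of the derived subgroup by class multiplication *)

Lemma lin_irr_class_term (i : Iirr G) (g : gT) :
  'chi_i \is a linear_char -> g \in (G^`(1))%g ->
  'chi_i x * 'chi_i x^-1%g * ('chi_i g)^* / 'chi_i 1%g = 1.
Proof.
move=> lin Dg; rewrite lin_charV // divff ?lin_char_neq0 //.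
have /cfker1-> : g \in cfker 'chi_i by apply: subsetP Dg; rewrite -lin_irr_der1.
by rewrite lin_char1 // conjC1 mul1r divr1.
Qed.

Lemma der1_dvd_sqr : (#|(G^`(1))%g| %| p ^ 2)%N.
Proof.
have [g Dg og] := Cauchy p_pr der1_dvd.
have Gg : g \in G := subsetP (der_sub 1 G) g Dg.
have pg : p.-elt g by rewrite /p_elt og pnat_id.
have ng : g != 1%g by rewrite -order_eq1 og; apply: contraTneq p_pr => ->.
pose cl y : 'I_#|classes G| := enum_rank_in (classes1 G) (y ^: G).
have clE y : y \in G -> enum_val (cl y) = y ^: G.
  by move=> Gy; rewrite enum_rankK_in ?mem_classes.
have Gx' := groupVr Gx.
(* The character formula for the class algebra constant [a], the number of factorisations of [g]
   into a conjugate of [x] and one of [x^-1]. *)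
have /= := @gring_classM_coef_sum_eq _ G (cl x) (cl x^-1%g) (cl g) x x^-1%g g.
rewrite !clE // !class_refl => /(_ isT isT isT).
set a := gring_classM_coef _ _ _.
have -> : #|x^-1%g ^: G| = p.
  by rewrite -card_xG classVg card_invg.
rewrite card_xG (bigID (fun i => 'chi_i \is a linear_char)) /=.
rewrite [X in _ + X]big1 ?addr0 => [|i nlin]; last first.
  have [p_chi1|p'chi1] := boolP (p %| Num.truncn ('chi_i 1%g))%N.
    by rewrite (irr_pelt_eq0 Gg pg ng p_chi1) conjC0 mulr0 mul0r.
  by rewrite irr_class_eq0_or_lin // !mul0r.
rewrite (eq_bigr (fun => 1)) => [|i lin]; last exact: lin_irr_class_term.
rewrite sumr_const card_lin_irr => aE.
have /eqP: (a * #|G|)%:R = (p ^ 2 * #|G : (G^`(1))%g|)%:R :> algC.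
  by rewrite natrM aE mulrAC divfK ?neq0CG // [in RHS]natrM.
rewrite eqr_nat -{1}(Lagrange (der_sub 1 G)) mulnA eqn_pmul2r ?indexg_gt0 //.
by move/eqP <-; apply: dvdn_mull.
Qed.

Lemma card_der1 : #|(G^`(1))%g| = p.
Proof.
have /(dvdn_pfactor _ _ p_pr)[k _ Dk] := der1_dvd_sqr.
have := dvdn_leq_log p (cardG_gt0 G) (cardSg (der_sub 1 G)).
have := der1_dvd; rewrite logn_card_prime_class Dk pfactorK //.
(* Exponents above 1 contradict the exact power of [p] in the group order, and exponent 0
   contradicts [der1_dvd]. *)
by case: k {Dk} => [|[|//]]; rewrite ?expn1 // dvdn1; case: eqP p_pr => // ->.
Qed.

(** * Affine coordinates on the class *)

Let f (g : gT) (i : 'Z_p) : gT := (x ^ (g ^+ i))%g.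

Lemma class_param_inj (g : gT) : g \in G -> #[g]%g = p -> injective (f g).
Proof.
move=> Gg og i j fij.
have pg : p.-elt g by rewrite /p_elt og pnat_id.
have ng : g != 1%g by rewrite -order_eq1 og; apply: contraTneq p_pr => ->.
have gij : (g ^+ i * (g ^+ j)^-1)%g = 1%g.
  apply: (class_stab_pelt_cent Gg pg ng).
    by rewrite cent1_pelt // groupM ?groupV ?mem_cycle.
  by rewrite conjgM -/(f g i) fij conjgK.
have /eqP : (g ^+ i = g ^+ j)%g by apply/eqP; rewrite eq_mulgV1 gij.
have lt_p (k : 'Z_p) : (k < p)%N by rewrite -[ltnRHS]Zp_cast ?prime_gt1.
by rewrite eq_expg_mod_order og !modn_small // => /eqP/val_inj.
Qed.

(** Any natural representative of a residue may serve as exponent, so computations modulo [p] can be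
    done on exponents. *)
Lemma class_paramE (g : gT) (n : nat) :
  #[g]%g = p -> f g n%:R = (x ^ (g ^+ n))%g.
Proof. by move=> og; rewrite /f val_Zp_nat ?prime_gt1 // -og expg_mod_order. Qed.

(** With [g ^ h = g ^+ a] by normality and [x ^ h = x ^ (g ^+ b)] by transitivity, conjugation by
    [h] sends the point of index [i] to that of index [a * i + b]. *)
Lemma class_param_affine (g h : gT) :
  g \in G -> #[g]%g = p -> <[g]>%g <| G -> h \in G ->
  exists2 s : {perm 'Z_p},
    s \in affine_set p & forall i, f g (s i) = (f g i ^ h)%g.
Proof.
move=> Gg og nsg Gh; have p_gt1 := prime_gt1 p_pr.
have pg : p.-elt g by rewrite /p_elt og pnat_id.
have ng : g != 1%g by rewrite -order_eq1 og; apply: contraTneq p_pr => ->.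
have /cycleP[a gh] : (g ^ h)%g \in <[g]>%g.
  by rewrite memJ_norm ?cycle_id // (subsetP (normal_norm nsg)).
have : (x ^ h)%g \in x ^: <[g]>.
  by rewrite (class_pelt_transitive Gg pg ng) memJ_class.
case/imsetP=> _ /cycleP[b ->] xh.
(* If [p] divided [a], the conjugate [g ^ h] would be trivial. *)
have ua : (a%:R : 'Z_p) \is a GRing.unit.
  rewrite unitZpE // prime_coprime // -og order_dvdn -gh.
  by rewrite conjg_eq1.
have affI : injective (fun i : 'Z_p => a%:R * i + b%:R).
  by move=> i j /addIr/(mulrI ua).
exists (perm affI).
  by apply/affine_setP; exists a%:R, b%:R; split=> // i; rewrite permE.
move=> i; rewrite permE -{1}(natr_Zp i) -natrM -natrD class_paramE // /f.
by rewrite -conjgM conjgC conjgM xh conjXg gh -conjgM -expgM -expgD addnC.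
Qed.

Lemma isog_affine_subgroup (g : gT) :
  g \in G -> #[g]%g = p -> <[g]>%g <| G ->
  exists H : {group {perm 'Z_p}}, H \subset affine_group p /\ (G \isog H)%g.
Proof.
move=> Gg og nsg; have p_gt1 := prime_gt1 p_pr.
have pg : p.-elt g by rewrite /p_elt og pnat_id.
have ng : g != 1%g by rewrite -order_eq1 og; apply: contraTneq p_pr => ->.
(* The default value 1 is never taken on [G], by [class_param_affine]; injectivity of [f g] then
   makes [phi] multiplicative. *)
pose phi (h : gT) : {perm 'Z_p} :=
  odflt 1%g [pick s in affine_set p | [forall i, f g (s i) == (f g i ^ h)%g]].
have phiP h : h \in G ->
    phi h \in affine_set p /\ forall i, f g (phi h i) = (f g i ^ h)%g.
  move=> Gh; rewrite /phi; case: pickP => [s /andP[As /forallP fs]|no] /=.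
    by split=> // i; apply/eqP.
  have [s As fs] := class_param_affine Gg og nsg Gh.
  by have /negP[] := no s; rewrite As; apply/forallP=> i; rewrite fs.
have phiM : {in G &, {morph phi : h k / (h * k)%g}}.
  move=> h k Gh Gk; apply/permP=> i; apply: (class_param_inj Gg og).
  have [_ fh] := phiP h Gh; have [_ fk] := phiP k Gk.
  have [_ fhk] := phiP _ (groupM Gh Gk).
  by rewrite permM fhk fk fh conjgM.
pose phi_m := Morphism phiM; exists (phi_m @* G)%G; split.
  by apply/subsetP=> _ /morphimP[h Gh _ ->]; have [] := phiP h Gh.
(* The kernel is trivial: its elements fix every [x ^ (g ^+ n)], hence the whole class. *)
apply: sub_isog => //; apply/subsetP=> h /morphpreP[Gh /set1P phi1].
apply/set1P; apply: centralise_class_eq1 => // y.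
rewrite -(class_pelt_transitive Gg pg ng) => /imsetP[_ /cycleP[n ->] ->].
have [_ /(_ n%:R)] := phiP h Gh.
by rewrite [phi h]phi1 perm1 class_paramE.
Qed.

End PrimeClass.

Theorem theorem4p1 (gT : finGroupType) (G : {group gT}) (C : {set gT}) (p : nat)
  (C_class : C \in classes G) (p_prime : prime p) (card_C : #|C| = p)
  (center_triv : 'Z(G)%g = 1%g) (gen_C : <<C>>%g = G) :
  exists H : {group {perm 'Z_p}}, H \subset affine_group p /\ (G \isog H)%g.
Proof.
have [x Gx Cx] := imsetP C_class; rewrite Cx in card_C gen_C.
have cardD := card_der1 Gx p_prime card_C center_triv gen_C.
have [|g Dg og] := @Cauchy _ p (G^`(1))%G p_prime; first by rewrite cardD.
have gD : <[g]>%g = (G^`(1))%g.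
  by apply/eqP; rewrite eqEcard cycle_subG Dg cardD -orderE og leqnn.
apply: (isog_affine_subgroup p_prime card_C center_triv gen_C (g := g)) => //.
  exact: subsetP (der_sub 1 G) g Dg.
by rewrite gD; apply: der_normal.
Qed.
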